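(* Let $(R,B)$ be any SP-game such that its illegal complex $\Gamma_{R,B}$ is a non-empty graph. Then there exists an invariant independence game $(R',B')$ such that the game trees of $(R,B)$ and $(R',B')$ are isomorphic.
   Context: A board is a finite graph. A ruleset $R$ specifies which pieces each of the two players, Left and Right, may place (each piece occupies a non-empty collection of vertices of the board) and which placements are legal; $(R,B)$ denotes the game with ruleset $R$ played on board $B$. A position is a configuration of pieces on the board. A basic position is the board with exactly one piece placed. A position is legal if it can be reached from the empty board by a sequence of legal moves, and illegal otherwise. A strong placement game (SP-game) is a combinatorial game (two players, perfect information, no chance, no simultaneous moves) such that: (i) the board is empty at the beginning; (ii) players place pieces on empty spaces of the board according to the rules; (iii) pieces are not moved or removed once placed; (iv) if a position can be reached through a sequence of legal moves, then any sequence of moves leading to this position consists of legal moves. Hence a position is identified with the set of basic positions it is made of, and every subset of a legal position is legal. An SP-ruleset is the ruleset of SP-games. The illegal complex $\Gamma_{R,B}$ is the simplicial complex on the set of basic positions whose facets are the minimal illegal positions (illegal positions all of whose proper subsets are legal); it is empty if there are no illegal positions. An illegal complex is a graph if its facets have one or two elements; an isolated vertex is a vertex $v$ such that $\{v\}$ is a facet. A board isomorphism between two boards (possibly already containing pieces) is a graph isomorphism such that a vertex contains a Left (respectively Right) piece if and only if its image does. An SP-ruleset is invariant if: every basic position is legal; and it does not depend on the board, i.e. for any board isomorphism between boards $B_1$ and $B_2$, a move in $B_1$ is legal if and only if its isomorphic image in $B_2$ is legal. An SP-ruleset $R$ is an independence ruleset if for every board $B$ the illegal complex $\Gamma_{R,B}$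 is a graph without isolated vertices, i.e. a pure one-dimensional simplicial complex (boards with no illegal positions, i.e. with empty illegal complex, are allowed). An SP-game $(R,B)$ is an independence game if $R$ is an independence ruleset; it is an invariant independence game if $R$ is in addition invariant. The game tree of a game is the rooted directed tree with edges labelled $L$ or $R$: the root is the empty board, the vertices correspond to positions (reached by moves of either player, in any order of players), and there is an edge $X\stackrel{L}{\rightarrow}Y$ (respectively $X\stackrel{R}{\rightarrow}Y$) for each legal move of Left (respectively Right) from $X$ to $Y$. Isomorphisms of game trees preserve the root and edge labels. *)

(* Defs.v *)
From mathcomp Require Import all_boot.

Set Implicit Arguments.
Unset Strict Implicit.
Unset Printing Implicit Defensive.

Record board := Board {
  vertex :> finType;
  adj : rel vertex;
  adj_sym : symmetric adj;
  adj_irr : irreflexive adj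
}.

Inductive player := Left | Right.

(* A placement (k, S) puts a piece of kind k, owned by [owner k], on the set
   of vertices S.  [basic B] lists the placements that put a piece on the
   board at all (the shape of the piece fits S), whether or not they are
   legal; these are the basic positions.  [legal_move X m]: from the
   configuration X, it is legal for the owner of m to place m. *)
Record ruleset := Ruleset {
  piece : finType;
  owner : piece -> player;
  basic : forall B : board, {set piece * {set B}};
  legal_move : forall B : board,
    {set piece * {set B}} -> pred (piece * {set B});
  basic_nonempty : forall (B : board) (m : piece * {set B}),
    m \in basic B -> m.2 != set0;
  legal_move_basic : forall (B : board) (X : {set piece * {set B}}) m,
    legal_move X m -> m \in basic B
}.

Definition placement (R : ruleset) (B : board) : finType :=
  (piece R * {set B})%type.

Definition mover (R : ruleset) (B : board) (m : placement R B) : player :=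
  owner m.1.

(* Pieces are neither moved nor removed, so the configuration reached by a
   sequence of moves is the set of its members; turns need not alternate. *)
Fixpoint legal_from (R : ruleset) (B : board) (X : {set placement R B})
    (s : seq (placement R B)) : bool :=
  if s is m :: s' then legal_move X m && legal_from (m |: X) s' else true.

Definition legal_play (R : ruleset) (B : board) (s : seq (placement R B)) :=
  legal_from set0 s.

Definition legal (R : ruleset) (B : board) (X : {set placement R B}) : Prop :=
  exists2 s : seq (placement R B), legal_play s & X = [set m in s].

Definition SP_game (R : ruleset) (B : board) : Prop :=
  (forall (X : {set placement R B}) (m : placement R B),
     legal X -> legal_move X m ->
     forall x, x \in X -> [disjoint x.2 & m.2]) /\
  (forall s t : seq (placement R B),
     legal_play s -> perm_eq s t -> legal_play t).

Definition SP_ruleset (R : ruleset) : Prop := forall B : board, SP_game R B.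

Definition facet (T : finType) (K : {set T} -> Prop) (F : {set T}) : Prop :=
  K F /\ forall G : {set T}, K G -> F \subset G -> G = F.

Definition nonempty_complex (T : finType) (K : {set T} -> Prop) : Prop :=
  exists F : {set T}, K F.

(* Satisfied by the complex without any face. *)
Definition is_graph (T : finType) (K : {set T} -> Prop) : Prop :=
  forall F : {set T}, facet K F -> #|F| = 1 \/ #|F| = 2.

Definition isolated (T : finType) (K : {set T} -> Prop) (v : T) : Prop :=
  facet K [set v].

(* Overlapping basic positions are allowed in X here: together they form an
   illegal position. *)
Definition minimal_illegal (R : ruleset) (B : board)
    (X : {set placement R B}) : Prop :=
  [/\ X \subset basic R B,
      ~ legal X
    & forall Y : {set placement R B}, Y \proper X -> legal Y].

Definition illegal_complex (R : ruleset) (B : board)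
    (X : {set placement R B}) : Prop :=
  exists2 F : {set placement R B}, minimal_illegal F & X \subset F.

Definition occupied (R : ruleset) (B : board) (X : {set placement R B})
    (p : player) (v : B) : Prop :=
  exists m : placement R B, [/\ m \in X, mover m = p & v \in m.2].

Definition board_iso (R : ruleset) (B1 B2 : board)
    (X1 : {set placement R B1}) (X2 : {set placement R B2})
    (f : B1 -> B2) : Prop :=
  [/\ bijective f,
      forall u v : B1, adj (f u) (f v) = adj u v
    & forall (p : player) (v : B1), occupied X1 p v <-> occupied X2 p (f v)].

Definition move_image (R : ruleset) (B1 B2 : board) (f : B1 -> B2)
    (m : placement R B1) : placement R B2 := (m.1, f @: m.2).

Definition invariant_ruleset (R : ruleset) : Prop :=
  (forall (B : board) (m : placement R B), m \in basic R B -> legal [set m]) /\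
  (forall (B1 B2 : board)
          (X1 : {set placement R B1}) (X2 : {set placement R B2})
          (f : B1 -> B2),
     legal X1 -> legal X2 -> board_iso X1 X2 f ->
     forall m : placement R B1,
       legal_move X1 m = legal_move X2 (move_image f m)).

Definition independence_ruleset (R : ruleset) : Prop :=
  SP_ruleset R /\
  forall B : board,
    is_graph (@illegal_complex R B) /\
    ~ exists v : placement R B, isolated (@illegal_complex R B) v.

Definition invariant_independence_game (R : ruleset) (B : board) : Prop :=
  independence_ruleset R /\ invariant_ruleset R.

Record rooted_digraph := RootedDigraph {
  node : Type;
  root : node;
  edge : player -> node -> node -> Prop
}.

Definition rooted_digraph_iso (T1 T2 : rooted_digraph) : Prop :=
  exists f : node T1 -> node T2,
    [/\ bijective f,
        f (root T1) = root T2
      & forall (p : player) (x y : node T1),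
          edge p x y <-> edge p (f x) (f y)].

(* As this is a tree, a position occurs once for each way of reaching it: a
   node is a legal play s, standing for the position [set m in s]. *)
Definition game_tree (R : ruleset) (B : board) : rooted_digraph :=
  @RootedDigraph {s : seq (placement R B) | legal_play s}
    (exist (fun s : seq (placement R B) => legal_play s) [::] isT)
    (fun p s t => exists2 m : placement R B,
       mover m = p & val t = rcons (val s) m).

(* Main.v *)
(** In an SP-game whose illegal complex is a graph, a play is legal iff each of
    its moves is legal on the empty board and any two of its moves are
    compatible.  Such a conflict relation is realised by pure overlap: each
    conflict is given a type of vertex, a piece covers all vertices
    whose type is a conflict it is involved in, and pieces may be placed freely
    on vertices that are still empty.  Taking the degree of a vertex as its
    type makes these rules invariant under board isomorphisms.  On every board
    the minimal illegal positions are then the pairs of overlapping pieces. *)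
Require Import Defs.
From mathcomp Require Import all_boot.

(** * Pairwise relations along sequences *)

Lemma uniq_in_pairwise {T : eqType} {r : rel T} {s : seq T} :
  uniq s -> {in s &, forall x y, x != y -> r x y} -> pairwise r s.
Proof.
elim: s => //= x s IHs /andP[xs us] rP; apply/andP; split; last first.
  by apply: IHs => // y z ys zs; apply: rP; rewrite inE ?ys ?zs orbT.
apply/allP => y ys; apply: rP; rewrite ?inE ?eqxx ?ys ?orbT //.
by apply: contraNneq xs => ->.
Qed.

Lemma pairwise_in {T : eqType} {r : rel T} {s : seq T} :
  symmetric r -> pairwise r s -> {in s &, forall x y, x != y -> r x y}.
Proof.
move=> rC; elim: s => //= x s IHs /andP[/allP rx /IHs rs] y z.
rewrite !inE => /predU1P[->|ys] /predU1P[->|zs]; rewrite ?eqxx //.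
- by move=> _; apply: rx.
- by move=> _; rewrite rC; apply: rx.
- exact: rs.
Qed.

(** * Legal plays in SP-games *)

Lemma legal_from_cat (R : ruleset) (B : board) (s t : seq (placement R B)) X :
  legal_from X (s ++ t) = legal_from X s && legal_from (X :|: [set m in s]) t.
Proof.
elim: s X => [|m s IHs] X /=.
  by congr legal_from; apply/setP => x; rewrite !inE orbF.
rewrite IHs andbA; congr (_ && legal_from _ _).
by apply/setP => x; rewrite !inE orbCA orbA.
Qed.

Lemma legal_from_basic {R : ruleset} {B : board} {s : seq (placement R B)} {X} :
  legal_from X s -> {subset s <= basic R B}.
Proof.
elim: s X => //= m s IHs X /andP[/legal_move_basic mB /IHs sB] x.
by rewrite inE => /predU1P[->|/sB].
Qed.

Lemma legal_play_rcons (R : ruleset) (B : board) (s : seq (placement R B)) m :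
  legal_play (rcons s m) = legal_play s && legal_move [set x in s] m.
Proof. by rewrite /legal_play -cats1 legal_from_cat /= andbT set0U. Qed.

(** A repeated piece would have to be disjoint from itself, yet pieces occupy non-empty sets. *)
Lemma legal_play_uniq {R : ruleset} {B : board} {s : seq (placement R B)} :
  SP_game R B -> legal_play s -> uniq s.
Proof.
case=> dis _; elim/last_ind: s => // s m IHs.
rewrite legal_play_rcons rcons_uniq => /andP[sL mL].
rewrite IHs // andbT; apply/negP => ms.
have sX : legal [set x in s] by exists s.
have /(dis _ _ sX mL) : m \in [set x in s] by rewrite inE.
by rewrite -setI_eq0 setIid (negPf (basic_nonempty (legal_move_basic mL))).
Qed.

(** Reordering [s] so that [t] comes first keeps it legal, and a prefix of a legal play is legal. *)
Lemma legal_play_sub {R : ruleset} {B : board} {s t : seq (placement R B)} :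
  SP_game R B -> legal_play s -> uniq t -> {subset t <= s} -> legal_play t.
Proof.
move=> SP sL ut ts; have us := legal_play_uniq SP sL.
have st : perm_eq s (t ++ [seq x <- s | x \notin t]).
  apply: uniq_perm => //.
    rewrite cat_uniq ut filter_uniq // andbT; apply/hasPn => x.
    by rewrite mem_filter => /andP[].
  move=> x; rewrite mem_cat mem_filter.
  by have [/ts|] := boolP (x \in t).
by have := SP.2 _ _ sL st; rewrite /legal_play legal_from_cat => /andP[].
Qed.

Lemma legal_playE {R : ruleset} {B : board} {s : seq (placement R B)} :
  SP_game R B -> uniq s -> legal [set x in s] -> legal_play s.
Proof.
move=> SP us [t tL /setP st]; apply: (legal_play_sub SP tL us) => x xs.
by have := st x; rewrite !inE xs.
Qed.

(** * Illegal complexes that are graphs *)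

Lemma minimal_illegal_facet (R : ruleset) (B : board)
    (F : {set placement R B}) :
  minimal_illegal F -> facet (@illegal_complex R B) F.
Proof.
move=> minF; split=> [|G [H [_ _ minH] GH] FG]; first by exists F.
have [FH|] := boolP (F \proper H); first by case: minF => _ []; apply: minH.
rewrite properE (subset_trans FG GH) negbK => HF.
by apply/eqP; rewrite eqEsubset FG (subset_trans GH HF).
Qed.

Lemma facet_minimal_illegal (R : ruleset) (B : board)
    (F : {set placement R B}) :
  facet (@illegal_complex R B) F -> minimal_illegal F.
Proof.
case=> -[G minG FG] maxF; rewrite -(maxF G) //.
by exists G.
Qed.

Definition compatible {R : ruleset} {B : board} : rel (placement R B) :=
  fun x y => legal_play [:: x; y].

Lemma compatible_sym {R : ruleset} {B : board} :
  SP_game R B -> symmetric (@compatible R B).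
Proof.
move=> SP x y.
by apply/idP/idP => xyL; apply: (SP.2 _ _ xyL); rewrite (perm_catC [:: _]).
Qed.

Lemma compatible_irr {R : ruleset} {B : board} :
  SP_game R B -> irreflexive (@compatible R B).
Proof.
move=> SP x; apply/negP; rewrite /compatible => /(legal_play_uniq SP).
by rewrite /= inE eqxx.
Qed.

(** For the converse, an illegal [s] contains a minimal illegal set. This is a facet, so it has one
    or two elements, and the right-hand side makes such subsets of [s] legal. *)
Lemma legal_play_graph {R : ruleset} {B : board} {s : seq (placement R B)} :
  SP_game R B -> is_graph (@illegal_complex R B) ->
  legal_play s = all (fun x => legal_play [:: x]) s && pairwise compatible s.
Proof.
move=> SP graph; apply/idP/andP => [sL|[/allP s1 s2]].
  split.
    apply/allP => x xs; apply: (legal_play_sub SP sL) => // y.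
    by rewrite inE => /eqP->.
  apply: uniq_in_pairwise (legal_play_uniq SP sL) _ => x y xs ys xy.
  apply: (legal_play_sub SP sL); first by rewrite /= inE xy.
  by move=> z; rewrite !inE => /orP[] /eqP->.
have us := pairwise_uniq (compatible_irr SP) s2.
have {}s2 := pairwise_in (compatible_sym SP) s2.
apply/negPn/negP => sNL.
(* Illegality is made boolean by playing the set in its enumeration order, so that a minimal illegal
   subset can be extracted. *)
pose illegal (Y : {set placement R B}) := ~~ legal_play (enum Y).
have enumK (Y : {set placement R B}) : [set x in enum Y] = Y.
  by apply/setP => x; rewrite inE mem_enum.
have [|F /minsetP[illF minF] Fs] := @minset_exists _ illegal [set x in s].
  apply: contra sNL => sL; apply: (legal_play_sub SP sL us) => x.
  by rewrite mem_enum inE.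
have /minimal_illegal_facet/graph : minimal_illegal F.
  split=> [|FL|Y].
  - apply/subsetP => x /(subsetP Fs); rewrite inE => /s1/legal_from_basic.
    by apply; rewrite inE.
  - by case/negP: illF; apply: (legal_playE SP); rewrite ?enum_uniq ?enumK.
  - rewrite properE => /andP[YF FY].
    exists (enum Y); last by rewrite enumK.
    by apply: contraNT FY => /minF/(_ YF)->.
move/negP: illF => illF cardF; apply: illF; case: cardF => /eqP cardF.
  case/cards1P: cardF => x Fx.
  rewrite Fx enum_set1; apply: s1.
  by have := subsetP Fs x; rewrite Fx !inE eqxx; apply.
case/cards2P: cardF => x [y [xy Fxy]].
have [xs ys] : x \in s /\ y \in s.
  by move: Fs; rewrite Fxy subUset !sub1set !inE => /andP[].
apply: (legal_play_sub SP (s2 x y xs ys xy) (enum_uniq _)) => z.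
by rewrite mem_enum Fxy !inE.
Qed.

(** * Rulesets given by degrees and overlap *)

Definition degree {B : board} (v : B) : nat := #|[pred w | adj v w]|.

Lemma degree_iso {B1 B2 : board} {f : B1 -> B2} :
  bijective f -> (forall u v : B1, adj (f u) (f v) = adj u v) ->
  forall v, degree (f v) = degree v.
Proof.
move=> fbij fadj v; rewrite /degree -(on_card_preimset (f := f)).
  by apply: eq_card => w; rewrite !inE fadj.
exact: onW_bij.
Qed.

Definition degree_set {K : Type} (D : K -> pred nat) (B : board) (k : K)
  : {set B} := [set v | D k (degree v)].

Lemma degree_set_iso {K : Type} (D : K -> pred nat) {B1 B2 : board}
    {f : B1 -> B2} (k : K) :
  bijective f -> (forall u v : B1, adj (f u) (f v) = adj u v) ->
  f @: degree_set D B1 k = degree_set D B2 k.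
Proof.
move=> fbij fadj; have [g fK gK] := fbij.
apply/setP => w; rewrite -(gK w) mem_imset; last exact: can_inj fK.
by rewrite !inE (degree_iso fbij fadj).
Qed.

(** A kind has a single shape on each board, hence at most one basic position there, and none if no
    vertex has a suitable degree. *)
Definition overlap_basic (K : finType) (D : K -> pred nat) (B : board)
  : {set K * {set B}} :=
  [set m | (m.2 == degree_set D B m.1) && (m.2 != set0)].

Definition overlap_move (K : finType) (D : K -> pred nat) (B : board)
    (X : {set K * {set B}}) : pred (K * {set B}) :=
  fun m => (m \in overlap_basic K D B) && [forall x in X, [disjoint x.2 & m.2]].

Lemma overlap_basic_nonempty (K : finType) (D : K -> pred nat) (B : board) m :
  m \in overlap_basic K D B -> m.2 != set0.
Proof. by rewrite inE => /andP[]. Qed.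

Lemma overlap_move_basic (K : finType) (D : K -> pred nat) (B : board) X m :
  overlap_move K D B X m -> m \in overlap_basic K D B.
Proof. by case/andP. Qed.

Definition overlap_ruleset (K : finType) (D : K -> pred nat)
    (own : K -> player) : ruleset :=
  @Ruleset K own (overlap_basic K D) (overlap_move K D)
    (@overlap_basic_nonempty K D) (@overlap_move_basic K D).

Definition apart {K : finType} {B : board} : rel (K * {set B}) :=
  fun x y => [disjoint x.2 & y.2].

Lemma apart_sym {K : finType} {B : board} : symmetric (@apart K B).
Proof. by move=> x y; apply: disjoint_sym. Qed.

Lemma overlap_play {K : finType} {D : K -> pred nat} {own : K -> player}
    {B : board} {s : seq (placement (overlap_ruleset K D own) B)} :
  legal_play s = all [in overlap_basic K D B] s && pairwise apart s.
Proof.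
elim/last_ind: s => // s m IHs.
rewrite legal_play_rcons IHs all_rcons pairwise_rcons /= /overlap_move.
have -> : [forall x in [set x in s], [disjoint x.2 & m.2]] =
          all (apart^~ m) s.
  apply/forall_inP/allP => [mL x xs|mL x]; first by apply: mL; rewrite inE.
  by rewrite inE => /mL.
by do ![case: (all _ _) => //=]; rewrite ?andbF ?andbT // andbC.
Qed.

Lemma overlap_play1 {K : finType} {D : K -> pred nat} {own : K -> player}
    {B : board} (m : placement (overlap_ruleset K D own) B) :
  legal_play [:: m] = (m \in overlap_basic K D B).
Proof. by rewrite overlap_play /= !andbT. Qed.

Lemma overlap_uniq {K : finType} {D : K -> pred nat} {B : board}
    {s : seq (K * {set B})} :
  all [in overlap_basic K D B] s -> pairwise apart s -> uniq s.
Proof.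
move=> sB; rewrite uniq_pairwise; apply: (sub_in_pairwise _ sB) => x y xB _ /=.
apply: contraTneq => <-; rewrite /apart -setI_eq0 setIid.
exact: overlap_basic_nonempty xB.
Qed.

(** The criterion of [overlap_play] does not depend on the order of the moves. *)
Lemma overlap_SP (K : finType) (D : K -> pred nat) (own : K -> player) :
  SP_ruleset (overlap_ruleset K D own).
Proof.
move=> B; split=> [X m _ /andP[_ /forall_inP mL] x /mL //|s t].
rewrite !overlap_play => /andP[sB sA] st.
have us := overlap_uniq sB sA.
rewrite -(perm_all _ st) sB; apply: uniq_in_pairwise.
  by rewrite -(perm_uniq st).
by move=> x y; rewrite -!(perm_mem st); apply: pairwise_in apart_sym sA _ _.
Qed.

(** If no two distinct pieces of [F] overlapped, listing [F] would be a legal play. So two of them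
    overlap, and by minimality they make up all of [F]. *)
Lemma overlap_facet {K : finType} {D : K -> pred nat} {own : K -> player}
    {B : board} {F : {set placement (overlap_ruleset K D own) B}} :
  facet (@illegal_complex (overlap_ruleset K D own) B) F -> #|F| = 2.
Proof.
case/facet_minimal_illegal => /subsetP FB illF minF.
have [/exists_inP[x xF /exists_inP[y yF /andP[xy NA]]]|allA] :=
  boolP [exists x in F, exists y in F, (x != y) && ~~ apart x y]; last first.
  case: illF; exists (enum F); last by apply/setP => x; rewrite inE mem_enum.
  rewrite overlap_play; apply/andP; split.
    by apply/allP => x; rewrite mem_enum => /FB.
  apply: uniq_in_pairwise (enum_uniq _) _ => x y.
  rewrite !mem_enum => xF yF xy; apply: contraNT allA => NA.
  by apply/exists_inP; exists x => //; apply/exists_inP; exists y; rewrite ?xy.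
suff -> : F = [set x; y] by rewrite cards2 xy.
apply/eqP; rewrite eq_sym; apply/negPn/negP => NF.
have /minF[s] : [set x; y] \proper F.
  by rewrite properEneq NF subUset !sub1set xF yF.
rewrite overlap_play => /andP[_ sA] /setP sE; case/negP: NA.
by apply: (pairwise_in apart_sym sA) => //; have := sE x; have := sE y;
  rewrite !inE !eqxx ?orbT.
Qed.

Lemma overlap_independence (K : finType) (D : K -> pred nat)
    (own : K -> player) : independence_ruleset (overlap_ruleset K D own).
Proof.
split=> [|B]; first exact: overlap_SP.
split=> [F /overlap_facet|[v /overlap_facet]]; first by right.
by rewrite cards1.
Qed.

(** Isomorphisms preserve degrees and hence shapes; beyond the shape, legality depends only on which
    vertices are occupied. *)
Lemma overlap_invariant (K : finType) (D : K -> pred nat)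
    (own : K -> player) : invariant_ruleset (overlap_ruleset K D own).
Proof.
split=> [B m mB|B1 B2 X1 X2 f _ _ [fbij fadj focc] m].
  exists [:: m]; first by rewrite overlap_play1.
  by apply/setP => x; rewrite !inE.
have f_inj := bij_inj fbij.
rewrite /= /overlap_move !inE /=.
rewrite -(degree_set_iso D m.1 fbij fadj) (inj_eq (imset_inj f_inj)).
rewrite imset_eq0; congr (_ && _).
apply/forall_inP/forall_inP => mL x xX;
  rewrite disjoint_subset; apply/subsetP => v vx.
- rewrite inE; apply/negP => /imsetP[w wm vw].
  (* The piece [y] covering [w] need not correspond to [x]: the isomorphism only matches occupied
     vertices, which suffices. *)
  have [|y [yX _ wy]] := (focc (own x.1) w).2.
    by exists x; rewrite -vw.
  by have := disjointFr (mL y yX) wy; rewrite wm.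
- rewrite inE; apply/negP => vm.
  have [|y [yX _ wy]] := (focc (own x.1) v).1.
    by exists x.
  by have := disjointFr (mL y yX) wy; rewrite imset_f.
Qed.

(** * Boards realising all small degrees *)

(* The half graph: [inl i] is adjacent to [inr j] iff [j < i], so that the
   vertices [inl i] realise every degree below [n]. *)
Definition half_adj (n : nat) : rel ('I_n + 'I_n)%type := fun u v =>
  match u, v with
  | inl i, inr j => j < i
  | inr j, inl i => j < i
  | _, _ => false
  end.

Lemma half_adj_sym (n : nat) : symmetric (half_adj n).
Proof. by move=> [i|i] [j|j]. Qed.

Lemma half_adj_irr (n : nat) : irreflexive (half_adj n).
Proof. by case. Qed.

Definition half_graph (n : nat) : board :=
  @Board ('I_n + 'I_n)%type (half_adj n) (half_adj_sym n) (half_adj_irr n).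

Lemma degree_half_graph {n : nat} (i : 'I_n) :
  degree (B := half_graph n) (inl i) = i.
Proof.
rewrite /degree -[RHS]card_ord -(card_image (f := fun j : 'I_i =>
  inr (widen_ord (ltnW (ltn_ord i)) j) : half_graph n)); last first.
  by move=> j k [] /val_inj.
apply: eq_card => -[j|j]; rewrite inE /=; first by apply/esym/imageP; case.
apply/idP/imageP => [ji|[k _ [->]]]; last exact: ltn_ord k.
by exists (Ordinal ji) => //; congr inr; apply: val_inj.
Qed.

(** * Realising conflicts as overlaps *)

Section Realisation.
Context (R : ruleset) (B : board).
Local Notation T := (placement R B).

(* The degrees encode the ordered pairs of incompatible placements.  A
   placement is incompatible with itself, so only those that are illegal on
   the empty board have no degree at all. *)
Definition conflict_degree (v : T) : pred nat := fun d =>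
  legal_play [:: v] && [exists p : T * T,
    [&& ~~ compatible p.1 p.2, (v == p.1) || (v == p.2) & d == enum_rank p]].

Definition realising_ruleset : ruleset :=
  overlap_ruleset T conflict_degree (@mover R B).

(** Every [enum_rank] of a pair lies below this size, so each conflict is the degree of some
    vertex. *)
Definition realising_board : board := half_graph #|{: T * T}|.

Definition realise (v : T) : placement realising_ruleset realising_board :=
  (v, degree_set conflict_degree realising_board v).

(** The degree of a common vertex encodes one conflict involving both placements; conversely, an
    incompatible pair has a vertex whose degree is its rank. *)
Lemma apart_realise (SP : SP_game R B) (v w : T) :
  legal_play [:: v] -> legal_play [:: w] ->
  apart (realise v) (realise w) = compatible v w.
Proof.
move=> vL wL; apply/idP/idP => [|vw]; last first.
  rewrite /apart disjoint_subset; apply/subsetP => u.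
  rewrite !inE /= => /andP[_ /existsP[p /and3P[pN vp /eqP->]]].
  apply/negP => /andP[_ /existsP[q /and3P[_ wp /eqP/val_inj/enum_rank_inj pq]]].
  rewrite -{q}pq in wp; case/negP: pN.
  have nrefl x : v = x -> w = x -> compatible x x.
    by move=> vx wx; rewrite -{1}vx -wx.
  (* If [v] and [w] are the same component of [p], irreflexivity is contradicted; otherwise [p] is
     the pair [v], [w] in some order. *)
  case/orP: vp => /eqP vp; case/orP: wp => /eqP wp.
  - by have := compatible_irr SP p.1; rewrite nrefl.
  - by rewrite -vp -wp.
  - by rewrite -vp -wp compatible_sym.
  - by have := compatible_irr SP p.2; rewrite nrefl.
apply: contraTT => vwN; apply/pred0Pn.
exists (inl (enum_rank (v, w))).
rewrite /= !inE degree_half_graph /conflict_degree vL wL /=.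
by apply/andP; split; apply/existsP; exists (v, w); rewrite /= vwN !eqxx ?orbT.
Qed.

(** A placement legal on the empty board conflicts with itself, which makes its shape non-empty; any
    other placement gets the empty shape. *)
Lemma realise_basic (SP : SP_game R B) (v : T) :
  (realise v \in overlap_basic T conflict_degree realising_board) =
  legal_play [:: v].
Proof.
rewrite inE eqxx /=; apply/set0Pn/idP => [[u]|vL].
  by rewrite inE => /andP[].
apply/set0Pn; have := apart_realise SP v v vL vL.
by rewrite /apart -setI_eq0 setIid compatible_irr // => ->.
Qed.

Lemma realise_play (SP : SP_game R B) (s : seq T) :
  is_graph (@illegal_complex R B) ->
  legal_play (map realise s) = legal_play s.
Proof.
move=> graph; rewrite overlap_play (legal_play_graph SP graph).
rewrite all_map pairwise_map (eq_all (realise_basic SP)).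
case: (boolP (all _ s)) => //= sL.
apply: (eq_in_pairwise _ sL) => v w vL wL.
exact: apart_realise.
Qed.

(** The kind of a basic position determines its vertices, so forgetting them loses nothing. *)
Lemma realise_fst {s : seq (placement realising_ruleset realising_board)} :
  legal_play s -> map realise (map fst s) = s.
Proof.
rewrite overlap_play => /andP[/allP sB _].
rewrite -map_comp; apply: map_id_in => -[k S] /sB.
by rewrite inE => /andP[/eqP /= ->].
Qed.

End Realisation.

Theorem corollary3p3 (R : ruleset) (B : board)
    (SP_RB : SP_game R B)
    (graph_RB : is_graph (@illegal_complex R B))
    (nonempty_RB : nonempty_complex (@illegal_complex R B)) :
  exists (R' : ruleset) (B' : board),
    invariant_independence_game R' B' /\
    rooted_digraph_iso (game_tree R B) (game_tree R' B').
Proof.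
exists (realising_ruleset R B), (realising_board R B); split.
  by split; [apply: overlap_independence | apply: overlap_invariant].
have playE s := realise_play R B SP_RB s graph_RB.
have to_play (s : node (game_tree R B)) :
    legal_play (map (realise R B) (val s)).
  by rewrite playE (valP s).
have of_play
    (s : node (game_tree (realising_ruleset R B) (realising_board R B))) :
    legal_play (map fst (val s) : seq (placement R B)).
  by rewrite -playE realise_fst // (valP s).
have realiseK : cancel (realise R B) fst by [].
(* Nodes are plays, so the isomorphism applies [realise] move by move, with inverse [map fst]. *)
exists (fun s => exist (fun u => legal_play u) _ (to_play s)); split.
- exists (fun s => exist (fun u => legal_play u) _ (of_play s)) => s; apply: val_inj => /=.
    exact: mapK.
  exact: realise_fst (valP s).
- exact: val_inj.
- move=> p s t; split=> -[m mp /= tE].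
    by exists (realise R B m); rewrite //= tE map_rcons.
  exists m.1 => //; apply: (inj_map (can_inj realiseK)); rewrite map_rcons tE.
  (* It remains that [m] is the image of its own kind, which holds because it ends the legal play
     obtained from [t]. *)
  congr rcons; rewrite -[RHS]/(realise R B m.1).
  have := realise_fst R B (to_play t); rewrite tE map_rcons map_rcons.
  by case/rcons_inj.
Qed.
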